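(* Let $n\ge1$, and let $u_1(a),\dots,u_{2n}(a)$ ($a\in\mathbb{R}$) be the one-parameter subgroups $u_i(a)=\exp(a e_i)$ of the electrical Lie group $EL_{2n}$. For $i,j\in\{1,\dots,2n\}$ and real $a,b,c$: (1) $u_i(a)u_i(b)=u_i(a+b)$; (2) $u_i(a)u_j(b)=u_j(b)u_i(a)$ if $|i-j|>1$; (3) if $|i-j|=1$ and $a+c+abc\neq0$, then $$u_i(a)u_j(b)u_i(c)=u_j\!\left(\frac{bc}{a+c+abc}\right)u_i(a+c+abc)\,u_j\!\left(\frac{ab}{a+c+abc}\right).$$
   Context: The electrical Lie algebra $\mathfrak{el}_{2n}$ is the real Lie algebra generated by $e_1,\dots,e_{2n}$ with relations $[e_i,e_j]=0$ for $|i-j|>1$ and $[e_i,[e_i,e_j]]=-2e_i$ for $|i-j|=1$. It is isomorphic to $\mathfrak{sp}_{2n}(\mathbb{R})$ (real $2n\times 2n$ block matrices $\begin{pmatrix} A&B\\ C&D\end{pmatrix}$ with $A=-D^T$, $B=B^T$, $C=C^T$) via $$e_{2i-1}\mapsto\begin{pmatrix}0&a_ia_i^T\\0&0\end{pmatrix},\qquad e_{2i}\mapsto\begin{pmatrix}0&0\\ b_ib_i^T&0\end{pmatrix}\qquad(1\le i\le n),$$ where $\varepsilon_1,\dots,\varepsilon_n$ is the standard basis of $\mathbb{R}^n$ (column vectors), $a_1=\varepsilon_1$, $a_i=\varepsilon_{i-1}+\varepsilon_i$ for $2\le i\le n$, and $b_i=\varepsilon_i$. The electrical Lie group $EL_{2n}$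 is the real symplectic group $Sp_{2n}(\mathbb{R})$ with Lie algebra identified with $\mathfrak{el}_{2n}$ in this way, and $u_i(a)=\exp(ae_i)$. *)

(* Defs.v *)
From HB Require Import structures.
From mathcomp Require Import all_boot all_order all_algebra.
From mathcomp Require Import all_classical all_reals all_analysis.
Set Implicit Arguments.
Unset Strict Implicit.
Unset Printing Implicit Defensive.
Import Order.TTheory GRing.Theory Num.Theory numFieldNormedType.Exports.
Local Open Scope classical_set_scope.
Local Open Scope ring_scope.

Definition expmx (R : realType) (m : nat) (A : 'M[R]_m) : 'M[R]_m :=
  limn (series (fun k => (k`!%:R)^-1 *: A ^+ k)).

Section ExpmxTheory.
Variables (R : realType) (m : nat).
Implicit Types A B : 'M[R]_m.

Let term A k := (k`!%:R)^-1 *: A ^+ k.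

Lemma entry_le_norm A i j : `|A i j| <= `|A|.
Proof.
rewrite [leRHS]/Num.Def.normr /= mx_normrE.
exact: (le_bigmax _ (fun ij : 'I_m * 'I_m => `|A ij.1 ij.2|) (i, j)).
Qed.

Lemma norm_le_entry A (c : R) :
  0 <= c -> (forall i j, `|A i j| <= c) -> `|A| <= c.
Proof.
move=> c0 Ac; rewrite [leLHS]/Num.Def.normr /= mx_normrE.
by apply/bigmax_leP; split=> // -[i j] _ /=.
Qed.

Lemma norm_mulmx A B : `|A *m B| <= m%:R * `|A| * `|B|.
Proof.
apply: norm_le_entry => [|i j]; first by rewrite !mulr_ge0.
rewrite mxE; apply: le_trans (ler_norm_sum _ _ _) _.
have -> : m%:R * `|A| * `|B| = \sum_(k < m) (`|A| * `|B|) :> R.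
  by rewrite sumr_const card_ord mulr_natl mulrnAl.
by apply: ler_sum => k _; rewrite normrM ler_pM ?entry_le_norm.
Qed.

Lemma norm_exprmx A k : `|A ^+ k| <= (m%:R * `|A|) ^+ k.
Proof.
elim: k => [|k IH].
  apply: norm_le_entry => [|i j]; rewrite ?expr0// mxE.
  by case: (i == j); rewrite ?normr0 ?normr1 ?ler01.
rewrite [A ^+ _]exprS [_ ^+ k.+1]exprS; apply: le_trans (norm_mulmx _ _) _.
by rewrite ler_wpM2l// mulr_ge0.
Qed.

Lemma mx_cvgP (f : nat -> 'M[R]_m) A :
  (forall i j, (fun N => f N i j) @ \oo --> A i j) -> f @ \oo --> A.
Proof.
move=> fA U /= [P /= AP PU].
have : \forall N \near \oo, forall i j, P i j (f N i j).
  apply: filter_forall => i; apply: filter_forall => j.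
  exact: (fA i j _ (AP i j)).
by apply: filterS => N /=; exact: PU.
Qed.

Lemma series_mxE (f : nat -> 'M[R]_m) N i j :
  series f N i j = series (fun k => f k i j) N.
Proof. by rewrite !seriesEord summxE. Qed.

Lemma cvg_expmx A : series (term A) @ \oo --> expmx A.
Proof.
pose limE := @cvg_lim _ (@norm_hausdorff R 'M[R]_m).
pose L : 'M[R]_m := \matrix_(i, j) limn (series (fun k => term A k i j)).
suff AL : series (term A) @ \oo --> L by rewrite /expmx (limE _ _ _ _ _ AL).
apply: mx_cvgP => i j; rewrite [L _ _]mxE.
rewrite (_ : (fun N => _) = series (fun k => term A k i j)); last first.
  by apply/funext => N; rewrite series_mxE.
apply: normed_cvg.
apply: (@series_le_cvg _ _ (exp_coeff (m%:R * `|A|))) => [n|n|n|].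
- exact: normr_ge0.
- by apply: exp_coeff_ge0; rewrite mulr_ge0.
- rewrite /exp_coeff /= /term mxE normrM mulrC.
  rewrite [X in _ * X]ger0_norm ?invr_ge0 // ler_wpM2r ?invr_ge0 //.
  exact: le_trans (entry_le_norm _ _ _) (norm_exprmx _ _).
- exact: is_cvg_series_exp_coeff.
Qed.

Lemma cvg_expmx_entry A i j :
  (fun N => series (term A) N i j) @ \oo --> expmx A i j.
Proof.
exact: (cvg_comp _ _ (@cvg_expmx A) (@coord_continuous _ _ _ i j _)).
Qed.

Lemma sum_triangle (V : nmodType) (g : nat -> nat -> V) N :
  \sum_(i < N) \sum_(j < N) g i j =
  \sum_(k < N) \sum_(i < k.+1) g i (k - i)%N +
  \sum_(i < N) \sum_(j < N | (N <= i + j)%N) g i j.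
Proof.
have -> : \sum_(k < N) \sum_(i < k.+1) g i (k - i)%N =
          \sum_(i < N) \sum_(j < N - i) g i j.
  elim: N => [|N IH]; first by rewrite !big_ord0.
  rewrite big_ord_recr IH /=.
  rewrite [RHS](eq_bigr (fun i : 'I_N.+1 =>
    \sum_(j < N - i) g i j + g i (N - i)%N)); last first.
    by move=> i _; rewrite subSn ?big_ord_recr//= -ltnS.
  by rewrite big_split /= [in RHS]big_ord_recr /= subnn big_ord0 addr0.
rewrite -big_split; apply: eq_bigr => i _ /=.
rewrite (bigID (fun j : 'I_N => (i + j < N)%N)) /=; congr (_ + _).
  rewrite (big_ord_widen_cond N predT (g i)) ?leq_subr//=.
  by apply: eq_bigl => j; rewrite ltn_subRL.
by apply: eq_bigl => j; rewrite -leqNgt.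
Qed.

Lemma binomial_exp_coeff (x y : R) k :
  \sum_(i < k.+1) exp_coeff x i * exp_coeff y (k - i)%N =
  exp_coeff (x + y) k.
Proof.
rewrite /exp_coeff /= addrC exprDn mulr_suml; apply: eq_bigr => i _.
have ik : (i <= k)%N by rewrite -ltnS.
have := bin_fact ik => /(congr1 (fun n => n%:R : R)); rewrite !natrM => kE.
have f0 n : n`!%:R != 0 :> R by rewrite pnatr_eq0 -lt0n fact_gt0.
have b0 : ('C(k, i))%:R != 0 :> R by rewrite pnatr_eq0 -lt0n bin_gt0.
rewrite -kE !invfM -[_ *+ 'C(k, i)]mulr_natr.
by rewrite mulrACA [y ^+ _ * _]mulrC -[RHS]mulrA mulVKf.
Qed.

Lemma term_mulN A i j : term (- A) i *m term A j =
  (exp_coeff (-1) i * exp_coeff 1 j) *: A ^+ (i + j).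
Proof.
have signE : (- A) ^+ i = (-1) ^+ i *: A ^+ i.
  elim: i => [|i IH]; first by rewrite !expr0 scale1r.
  by rewrite !exprS IH !mulNr -!mulmxE mul1r scaleNr -scalemxAr.
rewrite /term -scalemxAl -scalemxAr signE -scalemxAl !scalerA exprD.
by congr (_ *: _); rewrite /exp_coeff /= expr1n mul1r mulrA mulrC mulrA.
Qed.

Lemma expmx_mulN A : expmx (- A) *m expmx A = 1%:M.
Proof.
pose c : R := m%:R * `|A|.
have c0 : 0 <= c by rewrite mulr_ge0.
pose S N := series (term (- A)) N *m series (term A) N.
pose g (x y : R) i j := exp_coeff x i * exp_coeff y j.
pose rest N := \sum_(i < N) \sum_(j < N | (N <= i + j)%N) g c c i j.
have restE N : rest N = series (exp_coeff c) N * series (exp_coeff c) N -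
                        series (exp_coeff (c + c)) N.
  rewrite !seriesEord /= mulr_suml.
  under [X in _ = X - _]eq_bigr do rewrite mulr_sumr.
  rewrite (sum_triangle (g c c)).
  under [X in X + _ - _]eq_bigr do rewrite binomial_exp_coeff.
  by rewrite addrAC subrr add0r.
have rest0 : rest @ \oo --> (0 : R).
  rewrite (_ : rest = fun N => series (exp_coeff c) N *
      series (exp_coeff c) N - series (exp_coeff (c + c)) N); last first.
    by apply/funext => N; rewrite restE.
  rewrite -(subrr (expR (c + c))) {1}expRD.
  by apply: cvgB; [apply: cvgM|]; apply: is_cvg_series_exp_coeff.
have SE N : S N.+1 - 1%:M = \sum_(i < N.+1)
    \sum_(j < N.+1 | (N.+1 <= i + j)%N) g (-1) 1 i j *: A ^+ (i + j).
  rewrite /S !seriesEord /= mulmx_suml.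
  under [X in X - _ = _]eq_bigr do rewrite mulmx_sumr.
  under [X in X - _ = _]eq_bigr => i _.
    under eq_bigr do rewrite term_mulN.
    over.
  rewrite (sum_triangle (fun i j => g (-1) 1 i j *: A ^+ (i + j))) addrAC.
  rewrite (_ : \sum_(k < N.+1) _ = 1%:M) ?subrr ?add0r//.
  rewrite big_ord_recl /= big_ord_recl big_ord0 /= addr0 big1 ?addr0.
    by rewrite /g /exp_coeff /= !expr0 invr1 !mulr1 scale1r.
  move=> k _; rewrite (eq_bigr (fun i : 'I_(lift ord0 k).+1 =>
      g (-1) 1 i (lift ord0 k - i)%N *: A ^+ (lift ord0 k))); last first.
    by move=> i _; rewrite subnKC// -ltnS.
  rewrite -scaler_suml binomial_exp_coeff addNr /exp_coeff /=.
  by rewrite expr0n /= mul0r scale0r.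
have Sle N : `|S N.+1 - 1%:M| <= rest N.+1.
  rewrite SE; apply: le_trans (ler_norm_sum _ _ _) _.
  apply: ler_sum => i _; apply: le_trans (ler_norm_sum _ _ _) _.
  apply: ler_sum => j _; rewrite normrZ /g /exp_coeff /=.
  rewrite expr1n mul1r !normrM normrX normrN1 expr1n mul1r.
  rewrite !ger0_norm ?invr_ge0// mulrACA mulrC -exprD.
  by rewrite ler_wpM2r ?mulr_ge0 ?invr_ge0// norm_exprmx.
apply/matrixP => i j.
have lim1 : (fun N => S N i j) @ \oo --> (expmx (- A) *m expmx A) i j.
  rewrite mxE; under eq_fun do rewrite mxE.
  by apply: cvg_big => [|k _]; [exact: add_continuous|
    apply: cvgM; exact: cvg_expmx_entry].
have lim2 : (fun N => S N i j) @ \oo --> (1%:M : 'M[R]_m) i j.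
  apply: (@cvg_sub0 _ _ _ _ _ _ (fun=> (1%:M : 'M[R]_m) i j)); last exact: cvg_cst.
  apply: norm_cvg0; apply: (@squeeze_cvgr _ _ _ _ (fun=> 0) rest) => //.
  - exists 1%N => // -[|N] //= _; rewrite normr_ge0 /=.
    apply: le_trans (Sle N); apply: le_trans (entry_le_norm _ i j).
    by rewrite [X in _ <= `|X|]mxE [X in _ <= `|_ + X|]mxE.
  - exact: cvg_cst.
exact: (cvg_unique _ lim1 lim2).
Qed.

Lemma expmx_tr_intertwine A B J :
  A^T *m J = J *m B -> (expmx A)^T *m J = J *m expmx B.
Proof.
move=> AJB.
have AJBk k : (A ^+ k)^T *m J = J *m B ^+ k.
  elim: k => [|k IH]; first by rewrite !expr0 trmx1 mul1mx mulmx1.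
  by rewrite exprSr exprS trmx_mul -mulmxA IH !mulmxA AJB.
apply/matrixP => i j.
have lim1 : (fun N => ((series (term A) N)^T *m J) i j) @ \oo -->
    ((expmx A)^T *m J) i j.
  rewrite mxE; under eq_fun do rewrite mxE.
  apply: cvg_big => [|k _]; first exact: add_continuous.
  apply: cvgM; last exact: cvg_cst.
  by rewrite mxE; under eq_fun do rewrite mxE; exact: cvg_expmx_entry.
have lim2 : (fun N => (J *m series (term B) N) i j) @ \oo -->
    (J *m expmx B) i j.
  rewrite mxE; under eq_fun do rewrite mxE.
  apply: cvg_big => [|k _]; first exact: add_continuous.
  by apply: cvgM; [exact: cvg_cst|exact: cvg_expmx_entry].
suff E : (fun N => ((series (term A) N)^T *m J) i j) =
         (fun N => (J *m series (term B) N) i j).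
  by rewrite E in lim1; exact: (cvg_unique _ lim1 lim2).
apply/funext => N.
rewrite !seriesEord /= raddf_sum mulmx_suml mulmx_sumr; congr (fun_of_matrix _ i j).
apply: eq_bigr => k _.
by rewrite /= /term linearZ /= -scalemxAl AJBk -scalemxAr.
Qed.

End ExpmxTheory.

Section Symplectic.
Variables (R : realType) (n : nat).

(* The Lie algebra sp_{2n}(R), as a type carrying its real vector space
   structure. *)
Definition sp_mem : {pred 'M[R]_(n + n)} := fun X =>
  [&& ulsubmx X == - (drsubmx X)^T,
      ursubmx X == (ursubmx X)^T & dlsubmx X == (dlsubmx X)^T].

Record sp := Sp_alg { sp_val :> 'M[R]_(n + n); _ : sp_val \in sp_mem }.

HB.instance Definition _ := [isSub for sp_val].
HB.instance Definition _ := [Choice of sp by <:].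

Lemma sp_mem_submod_closed : submod_closed sp_mem.
Proof.
split=> [|a X Y]; rewrite !unfold_in /sp_mem.
  by apply/and3P; split; apply/eqP/matrixP => i j; rewrite !mxE ?oppr0.
move=> /and3P[/eqP Xul /eqP Xur /eqP Xdl] /and3P[/eqP Yul /eqP Yur /eqP Ydl].
have entry (M N : 'M[R]_n) i j : M = N -> M i j = N i j by move=> ->.
apply/and3P; split; apply/eqP/matrixP => i j.
- move: (entry _ _ i j Xul) (entry _ _ i j Yul); rewrite !mxE => -> ->.
  by rewrite opprD mulrN.
- by move: (entry _ _ i j Xur) (entry _ _ i j Yur); rewrite !mxE => -> ->.
- by move: (entry _ _ i j Xdl) (entry _ _ i j Ydl); rewrite !mxE => -> ->.
Qed.

HB.instance Definition _ :=
  GRing.isSubmodClosed.Build R 'M[R]_(n + n) sp_mem sp_mem_submod_closed.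
HB.instance Definition _ := [SubChoice_isSubLmodule of sp by <:].

Definition Jmx : 'M[R]_(n + n) := block_mx 0 1%:M (- 1%:M) 0.

(* The symplectic group Sp_{2n}(R), as a type with a group structure in
   group_scope; its Lie algebra is sp for this choice of the form Jmx. *)
Definition Sp_mem : {pred 'M[R]_(n + n)} := fun M => M^T *m Jmx *m M == Jmx.

Record Sp := Sp_grp { Sp_val :> 'M[R]_(n + n); _ : Sp_val \in Sp_mem }.

HB.instance Definition _ := [isSub for Sp_val].
HB.instance Definition _ := [Choice of Sp by <:].

Lemma SpP (M : Sp) : M^T *m Jmx *m M = Jmx.
Proof. by apply/eqP; case: M. Qed.

Lemma mulJJ : Jmx *m Jmx = - 1%:M.
Proof.
rewrite mulmx_block !(mul0mx, mulmx0, add0r, addr0, mul1mx, mulmx1).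
by rewrite (@scalar_mx_block _ n n 1) opp_block_mx oppr0.
Qed.

Lemma trJ : Jmx^T = - Jmx.
Proof.
by rewrite /Jmx tr_block_mx opp_block_mx !trmx0 oppr0 opprK [(- 1%:M)^T]linearN /= trmx1.
Qed.

Lemma Sp1_subproof : 1%:M \in Sp_mem.
Proof. by rewrite unfold_in /Sp_mem trmx1 mul1mx mulmx1. Qed.

Lemma SpM_subproof (M N : Sp) : M *m N \in Sp_mem.
Proof.
rewrite unfold_in /Sp_mem trmx_mul !mulmxA -(mulmxA N^T) -(mulmxA N^T).
by rewrite SpP SpP.
Qed.

Definition Sp_inv_mx (M : 'M[R]_(n + n)) := - (Jmx *m M^T *m Jmx).

Lemma Sp_mulVmx (M : Sp) : Sp_inv_mx M *m M = 1%:M.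
Proof. by rewrite mulNmx -!mulmxA (mulmxA M^T) SpP mulJJ opprK. Qed.

Lemma SpV_subproof (M : Sp) : Sp_inv_mx M \in Sp_mem.
Proof.
have MV : M *m Sp_inv_mx M = 1%:M by apply: mulmx1C; exact: Sp_mulVmx.
rewrite unfold_in /Sp_mem -{1}(SpP M) !mulmxA -trmx_mul MV trmx1 mul1mx.
by rewrite -mulmxA MV mulmx1.
Qed.

Let Sp_one := Sp_grp Sp1_subproof.
Let Sp_mul (M N : Sp) := Sp_grp (SpM_subproof M N).
Let Sp_inv (M : Sp) := Sp_grp (SpV_subproof M).

Lemma Sp_mulA : associative Sp_mul.
Proof. by move=> L M N; apply: val_inj; rewrite /= mulmxA. Qed.
Lemma Sp_mul1 : left_id Sp_one Sp_mul.
Proof. by move=> M; apply: val_inj; rewrite /= mul1mx. Qed.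
Lemma Sp_mulr1 : right_id Sp_one Sp_mul.
Proof. by move=> M; apply: val_inj; rewrite /= mulmx1. Qed.
Lemma Sp_mulV : left_inverse Sp_one Sp_inv Sp_mul.
Proof. by move=> M; apply: val_inj; exact: Sp_mulVmx. Qed.
Lemma Sp_mulrV : right_inverse Sp_one Sp_inv Sp_mul.
Proof. by move=> M; apply: val_inj; apply: mulmx1C; exact: Sp_mulVmx. Qed.

HB.instance Definition _ :=
  isGroup.Build Sp Sp_mulA Sp_mul1 Sp_mulr1 Sp_mulV Sp_mulrV.

Lemma sp_tr_mulJ (X : sp) : X^T *m Jmx = Jmx *m - (X : 'M[R]_(n + n)).
Proof.
case: X => X /= /and3P[/eqP ul /eqP ur /eqP dl].
rewrite -[X]submxK /Jmx tr_block_mx opp_block_mx !mulmx_block.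
rewrite !(mul0mx, mulmx0, add0r, addr0, mul1mx, mulmx1, mulmxN, mulNmx).
by rewrite opprK -ur -dl ul linearN /= trmxK opprK.
Qed.

Lemma exp_subproof (X : sp) : expmx (X : 'M[R]_(n + n)) \in Sp_mem.
Proof.
by rewrite unfold_in /Sp_mem (expmx_tr_intertwine (sp_tr_mulJ X))
  -mulmxA expmx_mulN mulmx1.
Qed.

Definition Sp_exp (X : sp) : Sp := Sp_grp (exp_subproof X).

End Symplectic.

Section Electrical.
Variables (R : realType) (n : nat).

(* Standard basis of column vectors, 1-based: eps 1, ..., eps n. *)
Definition eps (k : nat) : 'cV[R]_n := \col_(l < n) (l.+1 == k)%:R.

Definition avec (k : nat) : 'cV[R]_n :=
  if k == 1%N then eps 1 else eps k.-1 + eps k.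

Definition bvec (k : nat) : 'cV[R]_n := eps k.

(* The generator e_i, 1-based: if i = 2k - 1 then uphalf i = k, and if i = 2k
   then i./2 = k.  Only the values for 1 <= i <= 2n are generators of el_{2n}. *)
Definition el_mx (i : nat) : 'M[R]_(n + n) :=
  if odd i then block_mx 0 (avec (uphalf i) *m (avec (uphalf i))^T) 0 0
  else block_mx 0 0 (bvec i./2 *m (bvec i./2)^T) 0.

Lemma el_mx_sp i : el_mx i \in @sp_mem R n.
Proof.
rewrite unfold_in /sp_mem /el_mx; case: ifP => _;
  rewrite block_mxKul block_mxKur block_mxKdl block_mxKdr;
  by rewrite ?linear0 ?oppr0 ?trmx_mul ?trmxK !eqxx.
Qed.

Definition el_gen (i : nat) : sp R n := Sp_alg (el_mx_sp i).

(* EL_{2n} is Sp_{2n}(R), with el_{2n} identified with sp_{2n}(R) by sending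
   its i-th generator to el_gen i. *)
Definition EL := Sp R n.
HB.instance Definition _ := Group.on EL.

Definition u_ (i : nat) (a : R) : EL := Sp_exp (a *: el_gen i).

End Electrical.

Arguments u_ {R} n i%_N a%_R.

(* Main.v *)
Require Import Defs.
From mathcomp Require Import all_boot all_order all_algebra.
From mathcomp Require Import all_classical all_reals all_analysis.
From mathcomp Require Import ring zify.
Import Order.TTheory GRing.Theory Num.Theory.
Local Open Scope ring_scope.

(** The generators e_i of sp_{2n} are matrices of rank one, e_i = p_i q_i with
    p_i a column and q_i a row, and the whole theorem rests on one computation,
    [el_row_colE]: the scalar q_i p_j is 1 if |i - j| = 1 and 0 otherwise.
    Write X = e_i and Y = e_j.  Then X Y = p_i (q_i p_j) q_j gives
      - X X = 0, so that the exponential series stops and u_i(a) = 1 + a X;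
      - X Y = Y X = 0 if |i - j| > 1;
      - X Y X = X and Y X Y = Y if |i - j| = 1.
    The first relation makes a |-> 1 + a X multiplicative, and the second makes
    1 + a X and 1 + b Y commute.  In the third case every product of three
    factors is a combination of 1, X, Y, X Y and Y X ([mul3_unipotent]):
      (1 + a X)(1 + b Y)(1 + c X)
        = 1 + (a + c + a b c) X + b Y + a b X Y + b c Y X.
    The same formula with X and Y exchanged expands
    (1 + p Y)(1 + d X)(1 + q Y), and the two expansions agree as soon as
    d = a + c + a b c, d p = b c, d q = a b and p + q + p d q = b.  When
    d != 0 the second and third equations determine p and q, and the fourth
    one follows: p + q + p d q = b (c + a + a b c) / d = b. *)

Lemma expmx_sq0 (R : realType) (m : nat) (A : 'M[R]_m) :
  A *m A = 0 -> expmx A = 1%:M + A.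
Proof.
move=> A2; apply: (@cvg_lim _ (@norm_hausdorff R 'M[R]_m)).
apply: cvg_near_cst; exists 2%N => // -[|[|N]] //= _.
rewrite seriesEord /= !big_ord_recl big1 => [|k _] /=.
  by rewrite /bump /= !invr1 !scale1r expr0 expr1 addr0.
by rewrite !exprS mulrA -[A * A]/(A *m A) A2 mul0r scaler0.
Qed.

Section Unipotent.
Variables (R : comPzRingType) (m : nat).
Implicit Types (X Y : 'M[R]_m) (a b c : R).

Lemma mul_unipotent X Y a b : X *m Y = 0 ->
  (1%:M + a *: X) *m (1%:M + b *: Y) = 1%:M + (a *: X + b *: Y).
Proof.
move=> XY; rewrite mulmxDl mul1mx mulmxDr mulmx1 -scalemxAl -scalemxAr XY.
by rewrite !scaler0 addr0 -addrA [b *: Y + _]addrC.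
Qed.

Lemma mul3_unipotent X Y a b c : X *m X = 0 -> X *m Y *m X = X ->
  (1%:M + a *: X) *m (1%:M + b *: Y) *m (1%:M + c *: X) =
  1%:M + (a + c + a * b * c) *: X + b *: Y
    + ((a * b) *: (X *m Y) + (b * c) *: (Y *m X)).
Proof.
move=> XX XYX.
rewrite !(mulmxDl, mulmxDr) !(mul1mx, mulmx1) -!(scalemxAl, scalemxAr).
rewrite -?scalemxAl !scalerA XX XYX scaler0 !scalerDl.
by apply/matrixP => r s; rewrite !mxE; ring.
Qed.

End Unipotent.

Section Generators.
Variables (R : realType) (n : nat).
Local Notation eps := (eps R n).
Local Notation avec := (avec R n).
Local Notation bvec := (bvec R n).
Local Notation el_mx := (el_mx R n).

Lemma eps_dot k l : (0 < k <= n)%N ->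
  (eps k)^T *m eps l = (k == l)%:R%:M :> 'M[R]_1.
Proof.
case: k => // k /= kn; apply/matrixP => x y; rewrite !ord1 !mxE.
rewrite (bigD1 (Ordinal kn)) //= !mxE eqxx mul1r big1 ?addr0 // => h hk.
rewrite !mxE eqSS (_ : (h == k :> nat) = false) ?mul0r //.
by apply: contra_neqF hk => /eqP hk; apply: val_inj.
Qed.

(** Since [eps 0 = 0], the generic formula also covers the exceptional
    vector a_1. *)
Lemma avecE k : avec k = eps k.-1 + eps k.
Proof.
rewrite /Defs.avec; case: eqP => // -> /=.
rewrite [X in X + _](_ : _ = 0) ?add0r //.
by apply/matrixP => x y; rewrite !mxE.
Qed.

Lemma bvec_avec_dot k l : (0 < l <= n)%N ->
  (bvec l)^T *m avec k = ((l == k.-1) || (l == k))%:R%:M :> 'M[R]_1.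
Proof.
move=> ln; rewrite avecE mulmxDr !eps_dot // -raddfD /= -natrD.
by congr (_%:R%:M); lia.
Qed.

Definition el_col (i : nat) : 'cV[R]_(n + n) :=
  if odd i then col_mx (avec (uphalf i)) 0 else col_mx 0 (bvec i./2).

Definition el_row (i : nat) : 'rV[R]_(n + n) :=
  if odd i then row_mx 0 (avec (uphalf i))^T else row_mx (bvec i./2)^T 0.

Lemma el_mx_rank1 i : el_mx i = el_col i *m el_row i.
Proof.
rewrite /Defs.el_mx /el_col /el_row; case: ifP => _;
  by rewrite mul_col_row !(mul0mx, mulmx0).
Qed.

(** Indices of equal parity pair to 0 because the nonzero halves of the row and
    of the column do not meet.  For opposite parities this is the product
    of a_k and b_l, with indices 2k - 1 and 2l: it is 1 exactly for
    l = k and l = k - 1, that is, when the two indices are neighbours. *)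
Lemma el_row_colE i j : (1 <= i <= 2 * n)%N -> (1 <= j <= 2 * n)%N ->
  el_row i *m el_col j = (`|i - j|%N == 1%N)%:R%:M.
Proof.
move=> hi hj; case: (boolP (odd i)) => oi; case: (boolP (odd j)) => oj.
- rewrite /el_row /el_col oi oj mul_row_col mul0mx mulmx0 addr0.
  by rewrite (_ : (_ == _) = false) ?raddf0 //; lia.
- rewrite /el_row /el_col oi (negPf oj) mul_row_col mul0mx add0r.
  rewrite -[LHS]trmxK trmx_mul trmxK bvec_avec_dot ?tr_scalar_mx; last by lia.
  by congr (_%:R%:M); lia.
- rewrite /el_row /el_col (negPf oi) oj mul_row_col mul0mx addr0.
  by rewrite bvec_avec_dot; [congr (_%:R%:M)|]; lia.
- rewrite /el_row /el_col (negPf oi) (negPf oj) mul_row_col mul0mx mulmx0.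
  by rewrite addr0 (_ : (_ == _) = false) ?raddf0 //; lia.
Qed.

Lemma mul_el_mx i j : (1 <= i <= 2 * n)%N -> (1 <= j <= 2 * n)%N ->
  el_mx i *m el_mx j =
  (`|i - j|%N == 1%N)%:R *: (el_col i *m el_row j).
Proof.
move=> hi hj; rewrite !el_mx_rank1 mulmxA -(mulmxA (el_col i)) el_row_colE //.
by rewrite mul_mx_scalar scalemxAl.
Qed.

Lemma el_mx_mul0 i j : (1 <= i <= 2 * n)%N -> (1 <= j <= 2 * n)%N ->
  `|i - j|%N != 1%N -> el_mx i *m el_mx j = 0.
Proof. by move=> hi hj /negPf ij; rewrite mul_el_mx // ij scale0r. Qed.

(** This is the defining relation [e_i, [e_i, e_j]] = - 2 e_i of the
    electrical Lie algebra: since e_i squares to 0, the double bracket is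
    - 2 e_i e_j e_i. *)
Lemma el_mx_braid i j : (1 <= i <= 2 * n)%N -> (1 <= j <= 2 * n)%N ->
  `|i - j|%N = 1%N -> el_mx i *m el_mx j *m el_mx i = el_mx i.
Proof.
move=> hi hj ij; rewrite mul_el_mx // ij scale1r !el_mx_rank1.
rewrite mulmxA -(mulmxA _ _ (el_col i)) el_row_colE // distnC ij.
by rewrite mulmx1.
Qed.

Lemma el_mx_sq0 i : (1 <= i <= 2 * n)%N -> el_mx i *m el_mx i = 0.
Proof. by move=> hi; rewrite el_mx_mul0 // distnn. Qed.

Lemma val_u i a : (1 <= i <= 2 * n)%N ->
  val (u_ n i a) = 1%:M + a *: el_mx i.
Proof.
move=> hi; rewrite /= expmx_sq0 // -scalemxAl -scalemxAr.
by rewrite el_mx_sq0 // !scaler0.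
Qed.

End Generators.

Lemma val_ELM (R : realType) (n : nat) (g h : EL R n) :
  val (g * h)%g = val g *m val h.
Proof. by []. Qed.

Theorem theorem4p1 (R : realType) (n : nat) (hn : (1 <= n)%N) (i j : nat)
    (hi : (1 <= i <= 2 * n)%N) (hj : (1 <= j <= 2 * n)%N) (a b c : R) :
  [/\ (u_ n i a * u_ n i b)%g = u_ n i (a + b),
      (1 < `|i - j|)%N ->
        (u_ n i a * u_ n j b)%g = (u_ n j b * u_ n i a)%g
    & `|i - j|%N = 1%N -> a + c + a * b * c != 0 ->
        (u_ n i a * u_ n j b * u_ n i c)%g =
        (u_ n j (b * c / (a + c + a * b * c))
         * u_ n i (a + c + a * b * c)
         * u_ n j (a * b / (a + c + a * b * c)))%g].
Proof.
split=> [|ij|ij d0]; apply: val_inj; rewrite !val_ELM !val_u //.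
- by rewrite mul_unipotent ?el_mx_sq0 // scalerDl.
- rewrite !mul_unipotent; first by rewrite [X in _ + X]addrC.
    by apply: el_mx_mul0; rewrite // distnC neq_ltn ij orbT.
  by apply: el_mx_mul0; rewrite // neq_ltn ij orbT.
- have ji : `|j - i|%N = 1%N by rewrite distnC.
  rewrite !mul3_unipotent ?el_mx_sq0 ?el_mx_braid //.
  set d := a + c + a * b * c in d0 *.
  have -> : b * c / d + a * b / d + b * c / d * d * (a * b / d) = b.
    by rewrite /d; field.
  rewrite divfK // mulrCA divff // mulr1.
  by rewrite (addrAC 1%:M) [X in _ + X]addrC.
Qed.
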